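(* Let $X$ be a compact Hausdorff space that admits a continuous surjection onto the Cantor cube $2^{\omega_1}$. Then $X$ does not have a $\mathbb{P}$-diagonal.
   Context: $2^{\omega_1}$ is the set of all functions $\omega_1\to 2=\{0,1\}$ with the product topology ($2$ discrete), where $\omega_1$ is the first uncountable ordinal. $\mathbb{P}$ denotes the set $\omega^\omega$ of all functions $f:\omega\to\omega$, with the product topology ($\omega$ discrete), so $\mathbb{P}$ is homeomorphic to the space of irrational numbers. It is ordered coordinatewise: $f\le g$ means $f(n)\le g(n)$ for all $n\in\omega$. A space $Z$ is $\mathbb{P}$-dominated if there is a cover $\{C_K : K \text{ a compact subset of } \mathbb{P}\}$ of $Z$ by compact subsets of $Z$ such that $K\subseteq L$ implies $C_K\subseteq C_L$. Equivalently, there is a family $\langle K_f : f\in\mathbb{P}\rangle$ of compact subsets of $Z$ with $\bigcup_{f\in\mathbb{P}}K_f=Z$ such that $f\le g$ implies $K_f\subseteq K_g$ (an order-preserving cover by compact sets). A space $X$ has a $\mathbb{P}$-diagonal if the subspace $X^2\setminus\Delta$ of $X^2$ is $\mathbb{P}$-dominated, where $\Delta=\{(x,x):x\in X\}$ is the diagonal. *)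

(* Defs.v *)
From mathcomp Require Import all_boot all_order all_algebra.
From mathcomp Require Import all_classical topology.
From mathcomp Require Import wochoice.

Set Implicit Arguments.
Unset Strict Implicit.
Unset Printing Implicit Defensive.

Local Open Scope classical_set_scope.

(* [le] is the non-strict order of the first uncountable ordinal.  These
   conditions determine [(W, le)] up to isomorphism; [is_omega1_exists] below
   shows that they are satisfiable. *)
Definition is_omega1 (W : Type) (le : rel W) : Prop :=
  [/\ well_order le,
      ~ countable [set: W] &
      forall x : W, countable [set y | le y x /\ y <> x]].

Definition cantor_cube (W : Type) : topologicalType := {ptws W -> bool}.

Definition baire_space : topologicalType := {ptws nat -> nat}.

(* The values of [C] at non-compact sets are irrelevant. *)
Definition P_dominated (Z : topologicalType) : Prop :=
  exists C : set baire_space -> set Z,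
    [/\ forall K, compact K -> compact (C K),
        \bigcup_(K in [set K | compact K]) C K = [set: Z] &
        forall K L, compact K -> compact L -> K `<=` L -> C K `<=` C L].

(* [set_type] carries the subspace topology. *)
Definition has_P_diagonal (X : topologicalType) : Prop :=
  P_dominated (set_type (~` @diagonal X)).

Lemma is_omega1_exists : exists (W : Type) (le : rel W), is_omega1 le.
Proof.
have [R Rwo] := well_ordering_principle (set nat).
have Rmin (A : set (set nat)) : A !=set0 ->
    exists2 z, A z & forall x, A x -> R z x.
  move=> [x Ax]; have [|z [[zA zmin] _]] := Rwo [pred y | `[<A y>]].
    by exists x; apply/asboolP.
  exists z; first exact/asboolP.
  by move=> y Ay; apply: zmin; apply/asboolP.
have Rtot x y : R x y \/ R y x.
  have [|z zxy zmin] := Rmin [set x; y]; first by exists x; left.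
  by case: zxy => <-; [left; apply: zmin; right | right; apply: zmin; left].
have Rxx x : R x x by case: (Rtot x x).
have Ranti x y : R x y -> R y x -> x = y.
  move=> xy yx; have [|z [_ zu]] := Rwo [pred u | (u == x) || (u == y)].
    by exists x; rewrite inE eqxx.
  have zx : z = x.
    by apply: zu; split=> [|u]; rewrite inE ?eqxx // => /orP[] /eqP ->.
  have zy : z = y.
    by apply: zu; split=> [|u]; rewrite inE ?eqxx ?orbT // => /orP[] /eqP ->.
  by rewrite -zx.
pose D : set (set nat) := [set x | countable [set y | R y x]].
exists (set_type D), (fun x y => R (set_val x) (set_val y)); split.
- apply: antisymmetric_well_order.
    by move=> x y /andP[xy yx]; apply/val_inj/Ranti.
  move=> A [x xA].
  have [|_ [z zA <-] zmin] := Rmin [set set_val u | u in [set u | u \in A]].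
    by exists (set_val x), x.
  by exists z; split=> // u uA; apply: zmin; exists u.
- move=> /countable_injP[f fi].
  have Dc : countable D.
    pose g x := if pselect (D x) is left Dx then f (SigSub (mem_set Dx)) else 0%N.
    apply/countable_injP; exists g => x y /set_mem Dx /set_mem Dy; rewrite /g.
    case: pselect => // Dx'; case: pselect => // Dy' /fi.
    by rewrite !in_setT => /(_ isT isT) /(congr1 val).
  have [DT|/existsNP Dn] := pselect (forall x, D x).
    have /countable_injP[h hi] : countable [set: set nat].
      by apply: sub_countable Dc; apply: subset_card_le => x _; exact: DT.
    pose S := [set n | exists2 B, h B = n & ~ B n].
    have nS : ~ S (h S).
      move=> [B hBS nB]; have BS : B = S by apply: hi; rewrite ?in_setT.
      by apply: (nB); rewrite BS; exists B => //; rewrite -BS.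
    by apply: (nS); exists S.
  have [z nDz zmin] := Rmin (~` D) Dn.
  apply: nDz; have /countable_injP[h hi] := Dc.
  apply/countable_injP; exists (fun x => if x == z then 0%N else (h x).+1).
  have ltD x : R x z -> x != z -> x \in D.
    move=> xz xnz; apply/mem_set; apply: contrapT => nDx.
    by move/eqP: xnz; apply; apply: Ranti => //; exact: zmin.
  move=> x y /set_mem xz /set_mem yz.
  case: eqVneq => [->|xnz]; case: eqVneq => [->|ynz] //= [].
  by apply: hi; exact: ltD.
- move=> x; have /countable_injP[h hi] : D (set_val x) := set_valP x.
  apply/countable_injP; exists (fun y => h (set_val y)).
  move=> y z /set_mem[yx _] /set_mem[zx _] hyz; apply: val_inj.
  by apply: hi => //; apply/mem_set.
Qed.

(* Main.v *)
Require Import Defs.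
From mathcomp Require Import all_boot all_order all_algebra.
From mathcomp Require Import all_classical topology.
From mathcomp Require Import zify.

Set Implicit Arguments.
Unset Strict Implicit.
Unset Printing Implicit Defensive.

Local Open Scope classical_set_scope.

(** Let [K g], for [g : nat -> nat], be the compact set that a P-diagonal assigns
    to the compact box [{h | h <= g}].  The sets [K g] increase with [g] and cover
    the complement of the diagonal of [X].  Two mechanisms drive the proof.

    First, functions [h k] with [h k] equal to [g] below [k] have a common upper
    bound ([agree_bound]).  So, once a branch [g] is fixed, countably many sets
    [K (h k)] lie in a single [K h].  [stable_branch] produces branches: for a
    property of a function and a condition, in an order where decreasing sequences
    of conditions have lower bounds, there are a condition [c] and a branch [g]
    such that below [c] the property is always realized by functions that agree
    with [g] arbitrarily far.

    Second, let [Z] be a minimal closed subset of [X] whose image projects onto all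
    the coordinates after [d].  Removing from [Z] an open set makes the projection
    miss a point, so by compactness every nonempty relatively open subset of [Z]
    contains [Z] intersected with a cylinder over finitely many coordinates after
    [d].  A compact set that misses the diagonal misses the square of some open
    set, hence the square of such a trace of a cylinder ([minimal_avoids]).  It is
    therefore enough to find such a [Z] and an [h] with [K h] meeting the squares
    of all the traces of cylinders; call this the goal for [Z].

    The combinatorial core is [tail_dense_exists]: a cover [L] of [W -> bool] that
    increases with [g : nat -> nat] has a member that meets every cylinder over
    finitely many coordinates beyond some [d].  Applied to the points above which
    [K g] has a pair in the square of a closed set [Y], it reaches the goal for
    [Y], except that [d] may be larger than wanted ([onto_tail_meets]).  To remove
    the exception, take a branch [g] stable for this conclusion below a closed set,
    and a minimal [Z] there.  For a pattern [p] and each [n] there is [h], equal to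
    [g] below [n], such that [K h] meets the squares of [Z], cut by [p] and by any
    pattern beyond a coordinate that depends on [p] and [n].  Countably many
    patterns [p] form a family closed under these coordinates, and a common bound
    of their functions [h] serves for all the patterns after [d].

    The core is proved in three cases, according to whether families of functions
    indexed by [W], which stands for the first uncountable ordinal, can dominate or
    be unbounded.
    - If such a family dominates all functions and no member of the cover is as
      wanted, a transfinite recursion strings together disjoint patterns, each
      missed by one member of a cofinal family of members; their union is a
      point that is not covered.
    - If every such family is bounded modulo finite sets, a stable branch yields,
      for each countable set of coordinates, a function that serves it, and one
      function bounds uncountably many of these.
    - Otherwise there is an unbounded increasing family [f], and counting the
      crossings of [f a] and [f b] defines points of which every uncountable set
      contains a countable subset dense beyond some coordinate
      ([scale_point_finally_dense]).  Finite pieces of such countable sets are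
      selected along a branch by a function that no family indexed by [W]
      dominates. *)

(** * Bounds for functions and stable branches *)

Definition agree_below (n : nat) (g h : nat -> nat) :=
  forall k, (k < n)%N -> h k = g k.

Definition le_fun (g h : nat -> nat) := forall k, (g k <= h k)%N.

Definition lt_eventually (g h : nat -> nat) :=
  exists N, forall k, (N <= k)%N -> (g k < h k)%N.

(** At each argument [x] only the finitely many [h k] with [k <= x] can exceed
    [g x]. *)
Lemma agree_bound (g : nat -> nat) (h : nat -> nat -> nat) :
  (forall k, agree_below k g (h k)) -> exists h', forall k, le_fun (h k) h'.
Proof.
move=> gh; exists (fun x => g x + \sum_(k < x.+1) h k x)%N => k x.
have [kx|xk] := leqP k x; last by rewrite gh ?leq_addr.
by rewrite (bigD1 (Ordinal (kx : k < x.+1)%N)) //= addnCA leq_addr.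
Qed.

Lemma increasing_above (g : nat -> nat) (h : nat -> nat -> nat) :
  exists t, [/\ {homo t : x y / (x < y)%N}, le_fun g t &
    forall k, lt_eventually (h k) t].
Proof.
pose s x := (g x + \sum_(k < x.+1) h k x)%N.
pose t x := (\sum_(y < x.+1) (s y).+1)%N.
have st x : (s x < t x)%N by rewrite /t big_ord_recr /= leq_addl.
exists t; split.
- move=> x y xy; elim: y xy => // y ih; rewrite ltnS leq_eqVlt => /orP[/eqP->|xy].
    by rewrite {2}/t big_ord_recr /= -/(t y) -addSnnS leq_addr.
  by apply: ltn_trans (ih xy) _; rewrite {2}/t big_ord_recr /= -/(t y) -addSnnS leq_addr.
- by move=> x; apply/ltnW/(leq_ltn_trans _ (st x)); rewrite leq_addr.
- move=> k; exists k => x kx; apply: leq_ltn_trans (st x).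
  by rewrite /s (bigD1 (Ordinal (kx : k < x.+1)%N)) //= addnCA leq_addr.
Qed.

Section StableBranch.
Variables (C : Type) (le : C -> C -> Prop).
Hypotheses (le_refl : forall c, le c c)
  (le_trans : forall a b c, le a b -> le b c -> le a c)
  (le_lim : forall c : nat -> C, (forall n, le (c n.+1) (c n)) ->
     exists c', forall n, le c' (c n)).
Variables (H : (nat -> nat) -> C -> Prop).
Hypotheses (H_mono : forall h c c', le c' c -> H h c' -> H h c)
  (H_all : forall c, exists h, H h c).

Let le_iter (c : nat -> C) : (forall n, le (c n.+1) (c n)) ->
  forall n m, (n <= m)%N -> le (c m) (c n).
Proof.
move=> cS n m /subnKC <-; elim: (m - n)%N => [|k ih]; first by rewrite addn0.
by rewrite addnS; exact: le_trans (cS _) ih.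
Qed.

Let persistent (c : C) (n : nat) (g : nat -> nat) :=
  forall c', le c' c -> exists h, agree_below n g h /\ H h c'.

Let persistent_step c n g : persistent c n g ->
  exists c' g', [/\ le c' c, agree_below n g g' & persistent c' n.+1 g'].
Proof.
move=> cn; apply: contrapT => no.
pose upd a k := if k == n then a else g k.
have step a c' : le c' c -> exists c'', le c'' c' /\
    forall h, agree_below n.+1 (upd a) h -> ~ H h c''.
  move=> c'c; apply: contrapT => no'; apply: no; exists c', (upd a); split=> //.
    by move=> k kn; rewrite /upd ltn_eqF.
  move=> c'' c''c'; apply: contrapT => no; apply: no'; exists c''; split=> // h ha Hh.
  by apply: no; exists h.
have [s sP] : {s : nat * {c' | le c' c} -> {c' | le c' c} &
    forall x, le (sval (s x)) (sval x.2) /\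
      forall h, agree_below n.+1 (upd x.1) h -> ~ H h (sval (s x))}.
  apply: (@choice _ _ (fun x y => le (sval y) (sval x.2) /\
      forall h, agree_below n.+1 (upd x.1) h -> ~ H h (sval y))) => -[a [c' c'c]].
  have [c'' [cc cH]] := step a c' c'c.
  by exists (exist _ c'' (le_trans cc c'c)).
pose fix cs a := if a is b.+1 then s (b, cs b) else exist _ c (le_refl c).
have [w wP] : exists w, forall a, le w (sval (cs a)).
  by apply: le_lim => a /=; have [] := sP (a, cs a).
have [h [hg Hh]] := cn w (wP 0%N).
have [_ /(_ h)] := sP (h n, cs (h n)); apply.
  move=> k; rewrite ltnS /upd leq_eqVlt.
  by case: eqP => [->//|_ /=]; exact: hg.
exact: H_mono (wP (h n).+1) Hh.
Qed.

(** If [persistent c n g] holds, some value [a] of [g] at [n] keeps it true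
    below [c]: otherwise conditions refuting [a = 0, 1, ...] in turn have a lower
    bound, which refutes all the values.  Iterating gives the branch. *)
Lemma stable_branch (c0 : C) : exists c g,
  forall c' n, le c' c -> exists h, agree_below n g h /\ H h c'.
Proof.
pose S := {x : nat * C * (nat -> nat) | persistent x.1.2 x.1.1 x.2}.
have [s sP] : {s : S -> S & forall x, let: (n, c, g) := sval x in
    let: (n', c', g') := sval (s x) in
    [/\ n' = n.+1, le c' c & agree_below n g g']}.
  apply: (@choice _ _ (fun x y => let: (n, c, g) := sval x in
    let: (n', c', g') := sval y in
    [/\ n' = n.+1, le c' c & agree_below n g g'])).
  move=> [[[n c] g] /= /persistent_step[c' [g' [c'c gg' P']]]].
  by exists (exist _ (n.+1, c', g') P').
have P0 : persistent c0 0 (fun=> 0%N).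
  by move=> c' _; have [h Hh] := H_all c'; exists h.
pose x k := iter k s (exist _ (0%N, c0, fun=> 0%N) P0).
pose cc k := (sval (x k)).1.2; pose gg k := (sval (x k)).2.
have xn k : (sval (x k)).1.1 = k.
  elim: k => // k; rewrite /x /= -/(x k); have := sP (x k).
  by case: (sval (x k)) => [[? ?] ?]; case: (sval (s _)) => [[? ?] ?] /= [-> _ _] ->.
have xS k : le (cc k.+1) (cc k) /\ agree_below k (gg k) (gg k.+1).
  have := sP (x k); have := xn k; rewrite /cc /gg /x /= -/(x k).
  by case: (sval (x k)) => [[? ?] ?]; case: (sval (s _)) => [[? ?] ?] /= <- [_ ? ?].
have [c cP] : exists c, forall n, le c (cc n).
  by apply: le_lim => k; have [] := xS k.
have gE m n : (n <= m)%N -> agree_below n (gg n) (gg m).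
  move/subnKC <-; elim: (m - n)%N => [|d ih] k kn; rewrite ?addn0 // addnS.
  have [_ ->] := xS (n + d)%N; first exact: ih.
  exact: leq_trans kn (leq_addr _ _).
exists c, (fun k => gg k.+1 k) => c' n c'c.
have : persistent (cc n) n (gg n) by rewrite -{2}(xn n); exact: (svalP (x n)).
case/(_ c' (le_trans c'c (cP n))) => h [hg Hh]; exists h; split=> // k kn.
by rewrite hg // (gE _ _ kn).
Qed.

End StableBranch.

(** * The first uncountable ordinal *)

(** The two countability axioms are the only form in which uncountability is used:
    they make every countable set bounded and every initial segment a sequence. *)
Record omega1_like (W : Type) (lt : W -> W -> Prop) : Prop := Omega1Like {
  o1_irr : forall a, ~ lt a a;
  o1_trans : forall a b c, lt a b -> lt b c -> lt a c;
  o1_total : forall a b, [\/ lt a b, a = b | lt b a];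
  o1_wf : well_founded lt;
  o1_segment : forall d, exists r : nat -> W, forall b, ~ lt d b -> exists i, r i = b;
  o1_bounded : forall r : nat -> W, exists d, forall i, lt (r i) d }.

Lemma omega1_likeP (W : Type) (le : rel W) : is_omega1 le ->
  omega1_like (fun a b => le a b /\ a <> b).
Proof.
case=> wo unc seg; pose lt a b := le a b /\ a <> b.
have minP (A : set W) : A !=set0 -> exists2 z, A z & forall x, A x -> le z x.
  move=> [x Ax]; have [|z [[zA zmin] _]] := wo [pred y | `[<A y>]].
    by exists x; apply/asboolP.
  exists z; first exact/asboolP.
  by move=> y Ay; apply: zmin; apply/asboolP.
have tot x y : le x y \/ le y x.
  have [|z zxy zmin] := minP [set x; y]; first by exists x; left.
  by case: zxy => <-; [left; apply: zmin; right | right; apply: zmin; left].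
have refl x : le x x by case: (tot x x).
have anti x y : le x y -> le y x -> x = y.
  move=> xy yx; have [|z [_ zu]] := wo [pred u | `[<u = x \/ u = y>]].
    by exists x; apply/asboolP; left.
  have zx : z = x.
    apply: zu; split=> [|u]; first by apply/asboolP; left.
    by move=> /asboolP[] ->.
  have zy : z = y.
    apply: zu; split=> [|u]; first by apply/asboolP; right.
    by move=> /asboolP[] ->.
  by rewrite -zx.
have trans x y z : le x y -> le y z -> le x z.
  move=> xy yz; have [|m mE mmin] := minP [set u | [\/ u = x, u = y | u = z]].
    by exists x; constructor 1.
  have mx := mmin x (Or31 _ _ erefl).
  have my := mmin y (Or32 _ _ erefl); have mz := mmin z (Or33 _ _ erefl).
  case: mE => mE; subst m => //.
    by rewrite (anti x y).
  by rewrite -(anti y z) // .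
have ltNle a b : ~ lt a b -> le b a.
  move=> nab; have [ab|//] := tot a b; have [->//|ab'] := pselect (a = b).
  by case: nab.
split.
- by move=> a [].
- move=> a b c [ab nab] [bc nbc]; split; first exact: trans bc.
  by move=> ac; subst c; apply: nab; exact: anti.
- move=> a b; have [->|ab] := pselect (a = b); first by constructor 2.
  by have [?|?] := tot a b; [constructor 1|constructor 3; split=> // ?; apply: ab].
- move=> a; apply: contrapT => na.
  have [|z nz zmin] := minP [set u | ~ Acc lt u]; first by exists a.
  apply: nz; constructor => y [yz nyz]; apply: contrapT => ny.
  by apply: nyz; apply: anti => //; exact: zmin.
- move=> d; have /countable_injP[f fi] := seg d.
  pose P n y := [/\ le y d, y <> d & f y = n].
  exists (fun k => if k is n.+1 then
    if pselect (exists y, P n y) is left e then projT1 (cid e) else d else d).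
  move=> b /ltNle bd; have [->|nbd] := pselect (b = d); first by exists 0%N.
  exists (f b).+1; case: pselect => [e|[]]; last by exists b.
  case: (cid e) => y /= [yd nyd fy]; apply: fi => //; exact/mem_set.
- move=> r; apply: contrapT => no; apply: unc.
  have : countable (\bigcup_i [set y | le y (r i)]).
    apply: bigcup_countable => // i _.
    have -> : [set y | le y (r i)] = [set y | le y (r i) /\ y <> r i] `|` [set r i].
      apply/seteqP; split=> y /=; last by case=> [[]|->].
      by move=> yr; have [->|?] := pselect (y = r i); [right|left].
    by rewrite -bigcup2E; apply: bigcup_countable => // -[|[|k]] _ /=.
  apply: sub_countable; apply: subset_card_le => d _.
  apply: contrapT => nd; apply: no; exists d => i; apply: contrapT => ni.
  by apply: nd; exists i => //; exact: ltNle.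
Qed.

(** [Phi w F t] may look at [F] only below [w]; the value [t0] fills the other
    arguments during the recursion. *)
Lemma well_founded_choice (W T : Type) (t0 : T) (lt : W -> W -> Prop)
    (Phi : W -> (W -> T) -> T -> Prop) :
  well_founded lt ->
  (forall w F F' t, (forall v, lt v w -> F v = F' v) -> Phi w F t -> Phi w F' t) ->
  (forall w F, exists t, Phi w F t) ->
  exists F, forall w, Phi w F (F w).
Proof.
move=> wf ext ex.
have [s sP] : {s : W * (W -> T) -> T & forall x, Phi x.1 x.2 (s x)}.
  by apply: (@choice _ _ (fun x t => Phi x.1 x.2 t)) => -[w F]; exact: ex.
pose extend w (f : forall v, lt v w -> T) v :=
  if pselect (lt v w) is left vw then f v vw else t0.
pose F := Fix wf (fun=> T) (fun w f => s (w, extend w f)).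
exists F => w; apply: (ext w (extend w (fun v _ => F v))).
  by move=> v vw; rewrite /extend; case: pselect.
rewrite {2}/F Fix_eq; first exact: (sP (w, _)).
move=> x f f' ff'; congr (s (_, _)); apply/funext => v; rewrite /extend.
by case: pselect.
Qed.

Section Omega1.
Variables (W : choiceType) (lt : W -> W -> Prop) (hW : omega1_like lt).

Let lt_trans := o1_trans hW.

Lemma o1_lt_le_trans a b c : lt a b -> ~ lt c b -> lt a c.
Proof. by move=> ab bc; case: (o1_total hW b c) => [/(lt_trans ab)|<-|/bc]. Qed.

Lemma o1_ltW a b : lt a b -> ~ lt b a.
Proof. by move=> ab /(lt_trans ab)/(o1_irr hW). Qed.

Lemma o1_bound (I : countType) (d0 : W) (r : I -> W) :
  exists d, lt d0 d /\ forall i, lt (r i) d.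
Proof.
have [d dP] := o1_bounded hW
  (fun n => if n is m.+1 then odflt d0 (omap r (unpickle m)) else d0).
exists d; split; first exact: (dP 0%N).
by move=> i; have := dP (pickle i).+1; rewrite pickleK.
Qed.

Lemma o1_bound2 (a b : W) : exists d, lt a d /\ lt b d.
Proof. by have [d [? /(_ tt)]] := o1_bound a (fun _ : unit => b); exists d. Qed.

Lemma o1_bound_seq (d0 : W) (s : seq W) :
  exists d, lt d0 d /\ forall b, b \in s -> lt b d.
Proof.
have [d [d0d dP]] := o1_bound d0 (nth d0 s); exists d; split=> // b bs.
by rewrite -(nth_index d0 bs).
Qed.

Definition cofinal (A : set W) := forall d, exists a, A a /\ lt d a.

Lemma cofinal_sub A B : A `<=` B -> cofinal A -> cofinal B.
Proof. by move=> AB cA d; have [a [/AB ? ?]] := cA d; exists a. Qed.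

Lemma cofinal_setT : cofinal setT.
Proof. by move=> d; have [e [_ de]] := o1_bound2 d d; exists e. Qed.

Lemma cofinal_above A d : cofinal A -> cofinal (A `&` [set a | lt d a]).
Proof.
move=> cA e; have [m [dm em]] := o1_bound2 d e; have [a [Aa ma]] := cA m.
by exists a; split; first split => //; exact: lt_trans ma.
Qed.

(** Cofinal sets play the part of uncountable sets, and sets that are not cofinal
    form a sigma-ideal. *)
Lemma cofinal_pigeonhole (I : countType) (w0 : W) (A : set W) (B : I -> set W) :
  A `<=` \bigcup_i B i -> cofinal A -> exists i, cofinal (A `&` B i).
Proof.
move=> AB cA; apply: contrapT => no.
have [r rP] : {r : I -> W & forall i a, A a -> B i a -> ~ lt (r i) a}.
  apply: (@choice _ _ (fun i d => forall a, A a -> B i a -> ~ lt d a)) => i.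
  apply: contrapT => no'; apply: no; exists i => d; apply: contrapT => no.
  by apply: no'; exists d => a Aa Ba da; apply: no; exists a.
have [d [_ dP]] := o1_bound w0 r; have [a [Aa da]] := cA d.
have [i _ Bia] := AB a Aa.
exact: rP i a Aa Bia (lt_trans (dP i) da).
Qed.

(** With finitely many classes a single class serves all the sets [A v], which a
    countable partition does not achieve. *)
Lemma cofinal_finite_pigeonhole (T : finType) (w0 : W) (c : W -> T) (A : nat -> set W) :
  (forall v w, (v <= w)%N -> A w `<=` A v) -> (forall v, cofinal (A v)) ->
  exists t, forall v, cofinal (A v `&` [set a | c a = t]).
Proof.
move=> Adec cA; apply: contrapT => no.
have [v vP] : {v : T -> nat & forall t, ~ cofinal (A (v t) `&` [set a | c a = t])}.
  apply: (@choice _ _ (fun t v => ~ cofinal (A v `&` [set a | c a = t]))) => t.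
  apply: contrapT => no'; apply: no; exists t => v.
  by apply: contrapT => nc; apply: no'; exists v.
have [t] := @cofinal_pigeonhole T w0 (A (\max_t v t)%N) (fun t => [set a | c a = t])
   (fun a _ => ex_intro2 _ _ (c a) I erefl) (cA _).
move=> ct; apply: (vP t); apply: cofinal_sub ct => a [Aa ca]; split=> //.
by apply: Adec Aa; exact: leq_bigmax.
Qed.

(** A pattern is a finite list of prescribed values, so that [extends] describes a
    basic clopen subset of the Cantor cube; a list that prescribes two values at one
    coordinate has no extension. *)
Definition pattern := seq (W * bool).

Definition extends (u : W -> bool) (p : pattern) :=
  forall q, q \in p -> u q.1 = q.2.

Definition above (d : W) (p : pattern) := forall q, q \in p -> lt d q.1.

Lemma pattern_enum (d : W) : exists E : nat -> pattern,
  forall p, (forall q, q \in p -> ~ lt d q.1) -> exists k, E k = p.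
Proof.
have [r rP] := o1_segment hW d.
exists (fun k => odflt [::] (omap (map (fun x : nat * bool => (r x.1, x.2))) (unpickle k))).
suff H p : (forall q, q \in p -> ~ lt d q.1) ->
    exists s, map (fun x : nat * bool => (r x.1, x.2)) s = p.
  by move=> p /H[s <-]; exists (pickle s); rewrite pickleK.
elim: p => [|[b e] p ih] pd; first by exists [::].
have [|s sp] := ih; first by move=> q qp; apply: pd; rewrite in_cons qp orbT.
have [|i ri] := rP b; first by apply: (pd (b, e)); rewrite mem_head.
by exists ((i, e) :: s); rewrite /= sp ri.
Qed.

Lemma scale_exists (G : W -> nat -> nat) : exists f : W -> nat -> nat,
  [/\ forall b, {homo f b : x y / (x < y)%N}, forall b, le_fun (G b) (f b) &
      forall a b, lt a b -> lt_eventually (f a) (f b)].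
Proof.
have [|w F F' t FF' [? ? h]|w F|f fP] := @well_founded_choice W (nat -> nat) (fun=> 0%N) lt
   (fun w F t => [/\ {homo t : x y / (x < y)%N}, le_fun (G w) t &
      forall v, lt v w -> lt_eventually (F v) t]).
- exact: o1_wf hW.
- by split=> // v vw; rewrite -FF'//; exact: h.
- have [r rP] := o1_segment hW w.
  have [t [? ? tP]] := increasing_above (G w) (fun k => F (r k)).
  exists t; split=> // v /o1_ltW/rP[i <-]; exact: tP.
by exists f; split=> [b|b|a b ab]; have [] := fP b => // _ _; apply.
Qed.

End Omega1.

(** * Points of the cube from an unbounded scale *)

Definition crossings (z g : nat -> nat) (n : nat) :=
  (\sum_(x < n) ((z x < g x) && (g x.+1 <= z x.+1)))%N.

(** The limit of the crossing numbers, with a default value in case there are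
    infinitely many crossings. *)
Definition oscillation (z g : nat -> nat) : nat :=
  xget 0%N [set c | exists n, forall m, (n <= m)%N -> crossings z g m = c].

Lemma crossings_eq z g z' g' n : (forall x, (x <= n)%N -> z x = z' x) ->
  (forall x, (x <= n)%N -> g x = g' x) -> crossings z g n = crossings z' g' n.
Proof.
move=> zz gg; apply: eq_bigr => x _.
by rewrite !zz ?gg // ltnW.
Qed.

Lemma crossings_below z g n m : (forall x, (n <= x)%N -> (z x < g x)%N) -> (n <= m)%N ->
  crossings z g m = crossings z g n.
Proof.
move=> below /subnKC <-; elim: (m - n)%N => [|k ih]; first by rewrite addn0.
rewrite addnS -ih /crossings big_ord_recr /=.
have /negbTE -> : ~~ (g (n + k).+1 <= z (n + k).+1)%N.
  by rewrite -ltnNge; apply: below; rewrite -addnS leq_addr.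
by rewrite andbF addn0.
Qed.

Lemma oscillationE z g n : (forall x, (n <= x)%N -> (z x < g x)%N) ->
  oscillation z g = crossings z g n.
Proof.
move=> below; rewrite /oscillation; case: xgetP => [c _ [m mc]|no].
  rewrite -(mc (maxn n m)) ?leq_maxr//.
  by rewrite (crossings_below below (leq_maxl n m)).
by exfalso; apply: (no (crossings z g n)); exists n => m; exact: crossings_below.
Qed.

(** From [n] to [m] the function [z] jumps above [g] at [n.+1], stays above it up
    to [q] because [g] is bounded by [M] there, and is below it from [q] on. *)
Lemma crossings_add1 z g n q m M :
  {homo z : x y / (x <= y)%N} -> (z n < g n)%N -> (n.+2 <= q <= m)%N ->
  (forall x, (x < q)%N -> (g x <= M)%N) -> (M <= z n.+1)%N ->
  (forall x, (q <= x <= m)%N -> (z x < g x)%N) ->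
  crossings z g m = (crossings z g n).+1.
Proof.
move=> zmono zn /andP[nq qm] gM Mz below.
have : (n.+1 <= m)%N by lia.
have step k : (n.+1 + k <= m)%N -> crossings z g (n.+1 + k) = (crossings z g n).+1.
  elim: k => [|k ih] km.
    by rewrite addn0 /crossings big_ord_recr /= zn (leq_trans (gM _ _) Mz) ?addn1.
  rewrite addnS {1}/crossings big_ord_recr /= -/(crossings _ _ _) ih; last by lia.
  suff -> : (z (n.+1 + k) < g (n.+1 + k)) && (g (n.+1 + k).+1 <= z (n.+1 + k).+1) = false.
    by rewrite addn0.
  apply/negP => /andP[zg gz]; have [kq|qk] := ltnP (n.+1 + k) q.
    have := leq_trans (gM _ kq) (leq_trans Mz (zmono _ _ (leq_addr k n.+1))).
    by rewrite leqNgt zg.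
  suff : (z (n.+1 + k).+1 < g (n.+1 + k).+1)%N by rewrite ltnNge gz.
  by apply: below; lia.
by move/subnKC => nm; rewrite -nm step // nm.
Qed.

(** The number [x] is read as [l + 2 ^ e] with [l < 2 ^ e]; then [e] codes a length
    and a finite table, and the bit says whether the table contains the initial
    segment of [g] of that length together with [l]. *)
Definition code_pattern (g : nat -> nat) (x : nat) : bool :=
  let e := trunc_log 2 x in
  if unpickle (head 0%N (CodeSeq.decode e)) is Some (N, tab) then
    (mkseq g N, (x - 2 ^ e)%N) \in (tab : seq (seq nat * nat)) else false.

(** The crossing numbers of interest are known up to unknown offsets [l j], but all
    grow by the same amount [i]; the table is chosen after the offsets. *)
Lemma code_pattern_independent (k N : nat) (t : 'I_k -> seq nat) (l : 'I_k -> nat)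
    (s : 'I_k -> bool) : injective t ->
  exists i, forall j g, mkseq g N = t j -> code_pattern g (l j + i.+1) = s j.
Proof.
move=> tinj.
pose tab := [seq (t j, l j) | j <- enum 'I_k & s j].
pose e := CodeSeq.code (pickle (N, tab) :: [seq l j | j <- enum 'I_k]).
have le_ j : (l j < e)%N.
  have /allP := CodeSeq.gtn_decode e; apply; rewrite CodeSeq.codeK in_cons.
  by apply/orP; right; apply: map_f; rewrite mem_enum.
(* The code [e] exceeds its entries [l j], so that [l j + 2 ^ e] decodes well. *)
exists (2 ^ e).-1 => j g gt; rewrite prednK ?expn_gt0//.
have -> : code_pattern g (l j + 2 ^ e) = ((t j, l j) \in tab).
  rewrite /code_pattern (_ : trunc_log 2 _ = e).
    by rewrite CodeSeq.codeK /= pickleK addnK gt.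
  apply: trunc_log_eq => //; rewrite leq_addl expnS mul2n -addnn ltn_add2r.
  by apply: leq_trans (le_ j) _; exact/ltnW/ltn_expl.
apply/idP/idP => [/mapP[j']|sj].
  by rewrite mem_filter => /andP[sj' _] [/tinj ->].
by apply/mapP; exists j; rewrite // mem_filter sj mem_enum.
Qed.

Section Scale.
Variables (W : choiceType) (lt : W -> W -> Prop) (hW : omega1_like lt) (w0 : W).
Variable f : W -> nat -> nat.
Hypotheses (f_incr : forall b, {homo f b : x y / (x < y)%N})
  (f_lt : forall a b, lt a b -> lt_eventually (f a) (f b))
  (f_unbounded : forall h, exists b, ~ lt_eventually (f b) h).

Let lt_trans := o1_trans hW.

Let f_mono b : {homo f b : x y / (x <= y)%N}.
Proof. by move=> x y; rewrite leq_eqVlt => /orP[/eqP->//|/f_incr/ltnW]. Qed.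

(** Otherwise a function eventually dominates all but countably many members of the
    scale in [A], hence, by cofinality, the whole scale. *)
Lemma scale_unbounded_level (A : set W) (N : nat) : cofinal lt A ->
  exists2 n, (N <= n)%N & forall v, cofinal lt (A `&` [set a | (v <= f a n)%N]).
Proof.
move=> cA; apply: contrapT => no.
have [v vP] : {v : nat -> nat * W & forall n, (N <= n)%N ->
    forall a, A a -> lt (v n).2 a -> (f a n < (v n).1)%N}.
  apply: (@choice _ _ (fun n (v : nat * W) => (N <= n)%N ->
      forall a, A a -> lt v.2 a -> (f a n < v.1)%N)) => n.
  have [Nn|_] := boolP (N <= n)%N; last by exists (0%N, w0).
  apply: contrapT => no'; apply: no; exists n => // v d.
  apply: contrapT => no; apply: no'; exists (v, d) => _ a Aa da.
  by rewrite ltnNge; apply/negP => va; apply: no; exists a.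
have [d [_ dP]] := o1_bound hW w0 (fun n => (v n).2).
have [b nb] := f_unbounded (fun n => (v n).1); apply: nb.
have [e [de be]] := o1_bound2 hW d b; have [a [Aa ea]] := cA e.
have [m mP] := f_lt (lt_trans be ea).
exists (maxn m N) => n; rewrite geq_max => /andP[mn Nn].
have da := lt_trans (dP n) (lt_trans de ea).
exact: ltn_trans (mP n mn) (vP n Nn a Aa da).
Qed.

(** The coordinates [F d j] of cofinally many tuples can be made large at once, but
    at different places [n j].  Taking the places with minimal sum keeps the values
    before [n j] below a fixed [M]. *)
Lemma scale_split (k : nat) (F : W -> 'I_k -> nat -> nat) (B : set W) (l0 N : nat) :
  (forall d j, B d -> {homo F d j : x y / (x <= y)%N}) ->
  (forall d j x, B d -> (l0 <= x)%N -> (f d x <= F d j x)%N) ->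
  cofinal lt B ->
  exists (n : 'I_k -> nat) M, (forall j, (N <= n j)%N) /\
    forall v, cofinal lt (B `&` [set d | forall j, (v <= F d j (n j))%N /\
       forall x, (x < n j)%N -> (F d j x <= M)%N]).
Proof.
move=> Fmono fF cB.
have [M0 cB1] : exists M0, cofinal lt (B `&` [set d | forall j, (F d j N <= M0)%N]).
  apply: (cofinal_pigeonhole hW w0 _ cB) => d Bd.
  exists (\max_j F d j N)%N => // j; exact: (@leq_bigmax _ (fun j => F d j N)).
set B1 := B `&` _ in cB1.
have [n' n'P cn'] := scale_unbounded_level (maxn N l0) cB1.
pose good (n : 'I_k -> nat) := (forall j, (N <= n j)%N) /\
  forall v, cofinal lt (B1 `&` [set d | forall j, (v <= F d j (n j))%N]).
have ex : exists m, `[< exists n, good n /\ (\sum_j n j)%N = m >].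
  exists (\sum_(j < k) n')%N; apply/asboolP; exists (fun=> n'); split=> //.
  split=> [j|v]; first by apply: leq_trans n'P; rewrite leq_maxl.
  apply: cofinal_sub (cn' v) => d [[Bd ?] vd]; split=> // j.
  by apply: leq_trans vd _; apply: fF => //; apply: leq_trans n'P; rewrite leq_maxr.
case: (ex_minnP ex) => m /asboolP[n [[Nn cn] nm]] mmin.
have low j : exists v, exists e, forall d, B1 d -> lt e d ->
    (forall i, (v <= F d i (n i))%N) -> (N < n j)%N -> (F d j (n j).-1 < v)%N.
  have [Nnj|] := boolP (N < n j)%N; last by exists 0%N, w0.
  apply: contrapT => no.
  pose n2 i := if i == j then (n j).-1 else n i.
  suff g2 : good n2.
    have /asboolP/mmin : exists n, good n /\ (\sum_j n j)%N = (\sum_j n2 j)%N by exists n2.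
    rewrite -nm (bigD1 j) //= [leqRHS](bigD1 j) //= /n2 eqxx.
    rewrite [in leqRHS](eq_bigr n) => [|i /negbTE-> //].
    by rewrite leq_add2r; lia.
  split=> [i|v e]; rewrite /n2; first by case: eqP => [_|//]; lia.
  apply: contrapT => no'; apply: no; exists v, e => d Bd ed vd _.
  rewrite ltnNge; apply/negP => vj; apply: no'; exists d; split=> //; split=> // i.
  by case: eqP => [->|].
have [v /(_ _)/cid-/all_sig[e eP]] := choice low.
exists n, (maxn M0 (\max_j v j))%N; split=> // w.
set M := maxn _ _.
have [D [_ DP]] := o1_bound hW w0 e.
move=> d0; have [d1 [Dd1 dd1]] := o1_bound2 hW D d0.
have [d [[Bd wd] d1d]] := cn (maxn w M) d1.
exists d; split; last exact: lt_trans d1d.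
split=> [|j]; first by case: Bd.
split=> [|x xn]; first by apply: leq_trans (wd j); rewrite leq_maxl.
have Fm := Fmono d j (proj1 Bd).
have [Nnj|nN] := ltnP N (n j); last first.
  have xN : (x <= N)%N by exact: leq_trans (ltnW xn) nN.
  exact: leq_trans (Fm _ _ xN) (leq_trans (proj2 Bd j) (leq_maxl _ _)).
have Mv : (v j <= M)%N by rewrite leq_max (leq_bigmax j) orbT.
apply: leq_trans Mv; have xp : (x <= (n j).-1)%N by lia.
apply: leq_trans (Fm _ _ xp) _; apply/ltnW/eP => //.
  exact: lt_trans (DP j) (lt_trans Dd1 d1d).
move=> i; apply: leq_trans (wd i); apply: leq_trans (leq_maxr _ _).
by rewrite leq_max (leq_bigmax j) orbT.
Qed.


Section Family.
Variables (k : nat) (F : W -> 'I_k -> nat -> nat) (l0 : nat) (B0 : set W).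
Hypotheses (F_mono : forall d j, B0 d -> {homo F d j : x y / (x <= y)%N})
  (f_le_F : forall d j x, B0 d -> (l0 <= x)%N -> (f d x <= F d j x)%N).

(** A state of the construction: on [A] and [B] all the pairs have made the same
    number [l j] of crossings before [n], every [f a] is below every [F d j] at [n],
    and at the next argument the [f a] are unbounded. *)
Definition oscillation_state (A B : set W) (n : nat) (l : 'I_k -> nat) :=
  [/\ forall v, cofinal lt (A `&` [set a | (v <= f a n.+1)%N]), cofinal lt B, B `<=` B0 &
    forall a d j, A a -> B d ->
      (f a n < F d j n)%N /\ crossings (f a) (F d j) n = l j].

Let split_family B N := fun BB0 : B `<=` B0 => @scale_split k F B l0 N
  (fun d j Bd => @F_mono d j (BB0 d Bd)) (fun d j x Bd => @f_le_F d j x (BB0 d Bd)).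

Let split_scale A N : cofinal lt A -> exists n M, (N <= n)%N /\
  forall v, cofinal lt (A `&` [set a | (v <= f a n)%N /\
    forall x, (x < n)%N -> (f a x <= M)%N]).
Proof.
move=> cA; have [n [M [Nn nM]]] := @scale_split 1 (fun a _ => f a) A 0 N
  (fun a _ _ => @f_mono a) (fun _ _ _ _ _ => leqnn _) cA.
exists (n ord0), M; split=> // v; apply: cofinal_sub (nM v) => a [Aa h].
by split=> //; exact: (h ord0).
Qed.

(** Choosing [f a] above the bound [M] of the values [F d j] before the places
    [q j], and then the values [F d j] at these places above a bound of [f a],
    produces exactly one more crossing in all the coordinates. *)
Lemma oscillation_step A B n l : oscillation_state A B n l ->
  exists A' B' n', [/\ A' `<=` A, B' `<=` B &
    oscillation_state A' B' n' (fun j => (l j).+1)].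
Proof.
move=> [cA cB BB0 AB]; have [q [M [nq qM]]] := split_family n.+2 BB0 cB.
have [[|m] [M2 [// qm mM]]] := split_scale (maxn n (\max_j q j)).+1 (cA M).
move: qm; rewrite ltnS geq_max => /andP[nm qm].
exists (A `&` [set a | (M <= f a n.+1)%N] `&`
  [set a | forall x, (x < m.+1)%N -> (f a x <= M2)%N]).
exists (B `&` [set d | forall j, (M2.+1 <= F d j (q j))%N /\
       forall x, (x < q j)%N -> (F d j x <= M)%N]).
exists m; split; [by move=> a [[]]|by move=> d []|split].
- by move=> v; apply: cofinal_sub (mM v) => a [Aa [? ?]]; split.
- exact: qM.
- by move=> d [/BB0].
- move=> a d j [[Aa Mfa] aM2] [Bd dP]; have [fn cl] := AB a d j Aa Bd.
  have [M2F FM] := dP j; have qjm : (q j <= m)%N := leq_trans (leq_bigmax j) qm.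
  have below x : (q j <= x <= m)%N -> (f a x < F d j x)%N.
    move=> /andP[qx xm]; apply: leq_ltn_trans (aM2 x xm) _.
    by apply: leq_trans M2F _; exact: F_mono (BB0 d Bd) _ _ qx.
  split; first by apply: below; rewrite qjm leqnn.
  rewrite -cl; apply: (@crossings_add1 _ _ n (q j) m M) => //.
  by rewrite nq qjm.
Qed.

(** As in [oscillation_step], but with a single [a] whose crossings must stop for
    good.  The threshold beyond which [f a] is below [F d j] has to be known before
    [F d j] is made large, whereas [a] depends on the bound [M]; so a countable
    family [al] provides for all [M], and one [c] above it makes the threshold
    depend on [M] alone. *)
Lemma oscillation_finish A B n l : oscillation_state A B n l ->
  exists a d, [/\ A a, B d, lt a d & forall j, oscillation (f a) (F d j) = (l j).+1].
Proof.
move=> [cA cB BB0 AB].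
have [al alP] : {al : nat -> W & forall M, A (al M) /\ (M <= f (al M) n.+1)%N}.
  apply: (@choice _ _ (fun M a => A a /\ (M <= f a n.+1)%N)) => M.
  by have [a [[]]] := cA M w0; exists a.
have [c [_ cP]] := o1_bound hW w0 al.
have [l1 cB1] : exists l1, cofinal lt (B `&` [set d | lt c d] `&`
    [set d | forall x, (l1 <= x)%N -> (f c x < f d x)%N]).
  apply: (cofinal_pigeonhole hW w0 _ (cofinal_above hW c cB)) => d [Bd cd].
  by have [N NP] := f_lt cd; exists N.
have B10 : B `&` [set d | lt c d] `&`
    [set d | forall x, (l1 <= x)%N -> (f c x < f d x)%N] `<=` B0.
  by move=> d [[/BB0]].
have [q [M [nq qM]]] := split_family n.+2 B10 cB1.
have [Aa Ma] := alP M; set a := al M in Aa Ma.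
have [L0 aL] := f_lt (cP M); rewrite -/a in aL.
pose L := maxn L0 (maxn l1 l0).
have [d [[[[Bd cd] dl1] dq] _]] := qM (f a L).+1 w0.
exists a, d; split=> //; first exact: lt_trans (cP M) cd.
move=> j; have [vF FM] := dq j; have [fn <-] := AB a d j Aa Bd.
have below x : (q j <= x)%N -> (f a x < F d j x)%N.
  move=> qx; have [Lx|/ltnW xL] := leqP L x.
    move: Lx; rewrite !geq_max => /and3P[L0x l1x l0x].
    apply: ltn_trans (aL x L0x) _; apply: leq_trans (dl1 x l1x) _.
    exact: f_le_F (BB0 d Bd) l0x.
  apply: leq_ltn_trans (@f_mono a _ _ xL) _; apply: leq_trans vF _.
  exact: F_mono (BB0 d Bd) _ _ qx.
rewrite (oscillationE below); apply: (@crossings_add1 _ _ n (q j) (q j) M) => //.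
  by rewrite nq leqnn.
by move=> x /andP[/below].
Qed.

Lemma oscillation_all A B n l i : oscillation_state A B n l ->
  exists a d, [/\ A a, B d, lt a d & forall j, oscillation (f a) (F d j) = (l j + i.+1)%N].
Proof.
elim: i A B n l => [|i ih] A B n l S.
  have [a [d [? ? ? adl]]] := oscillation_finish S; exists a, d; split=> // j.
  by rewrite adl addn1.
have [A' [B' [n' [AA BB S']]]] := oscillation_step S.
have [a [d [/AA ? /BB ? ? adl]]] := ih _ _ _ _ S'; exists a, d; split=> // j.
by rewrite adl addSnnS.
Qed.

(** Two applications of splitting bring [f a] below [F d j]; the number of crossings
    made until then is arbitrary, and pigeonholes make it constant. *)
Lemma oscillation_start A B : cofinal lt A -> cofinal lt B -> B `<=` B0 ->
  exists A' B' n l, [/\ A' `<=` A, B' `<=` B & oscillation_state A' B' n l].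
Proof.
move=> cA cB BB0; have [q [M [_ qM]]] := split_family 0 BB0 cB.
have [[|m] [M2 [// qm mM]]] := split_scale (\max_j q j).+1 cA.
pose ca a := [ffun x : 'I_m.+1 => inord (f a x) : 'I_M2.+1].
have [|t tP] := cofinal_finite_pigeonhole hW w0 ca _ mM.
  by move=> v w vw a [Aa [wa ?]]; split=> //; split=> //; exact: leq_trans vw wa.
pose cb d := [ffun x : 'I_k * 'I_m.+1 => F d x.1 x.2].
have [t' t'P] := @cofinal_pigeonhole _ _ hW {ffun 'I_k * 'I_m.+1 -> nat} w0 _
   (fun t => [set d | cb d = t])
   (fun d _ => ex_intro2 _ _ (cb d) I erefl) (qM M2.+1).
set A' := A `&` [set a | forall x, (x < m.+1)%N -> (f a x <= M2)%N] `&` [set a | ca a = t].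
set B' := _ `&` _ in t'P.
have [a0 [[[Aa0 [_ a0M]] a0t] _]] := tP 0%N w0.
have [d0 [Bd0 _]] := t'P w0.
have BB' : B' `<=` B by move=> d [[]].
exists A', B', m, (fun j => crossings (f a0) (F d0 j) m); split=> //.
  by move=> a [[]].
split=> //.
- by move=> v; apply: cofinal_sub (tP v) => a [[? [? ?]] ?].
- by move=> d /BB'/BB0.
move=> a d j [[Aa aM] at_] Bd; split.
  have [[Bd_ dP] _] := Bd.
  apply: leq_ltn_trans (aM m (ltnSn _)) _; apply: leq_trans (proj1 (dP j)) _.
  apply: F_mono (BB0 d Bd_) _ _ _; exact: leq_trans (leq_bigmax j) qm.
apply: crossings_eq => x xm.
  have /ffunP/(_ (Ordinal (xm : x < m.+1)%N)) : ca a = ca a0 by rewrite at_.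
  by rewrite !ffunE => /(congr1 val) /=; rewrite !inordK // ltnS ?aM ?a0M.
have /ffunP/(_ (j, Ordinal (xm : x < m.+1)%N)) : cb d = cb d0.
  by rewrite (proj2 Bd) (proj2 Bd0).
by rewrite !ffunE.
Qed.

End Family.

Definition scale_point (a : W) (b : W) : bool :=
  code_pattern (f b) (oscillation (f a) (f b)).

(** Suppose that for each [d] a pattern [s d] beyond [d] is extended by no point
    [scale_point a] with [a] in [A] before [d].  On a cofinal set of indices [d] the
    patterns have the same size and values, and their coordinates the same initial
    segments of [f].  By [oscillation_all] there are then [a] before [d] whose
    crossing numbers with the coordinates of [s d] are any common shift of fixed
    offsets, and [code_pattern_independent] chooses the shift that realizes the
    pattern. *)
Lemma scale_point_finally_dense (A : set W) : cofinal lt A ->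
  exists d, forall p u, above lt d p -> extends u p ->
    exists a, [/\ A a, lt a d & extends (scale_point a) p].
Proof.
move=> cA; apply: contrapT => no.
have [s sP] : {s : W -> pattern W * (W -> bool) & forall d,
    [/\ above lt d (s d).1, extends (s d).2 (s d).1 &
        forall a, A a -> lt a d -> ~ extends (scale_point a) (s d).1]}.
  apply: (@choice _ _ (fun d (s : pattern W * (W -> bool)) =>
    [/\ above lt d s.1, extends s.2 s.1 &
        forall a, A a -> lt a d -> ~ extends (scale_point a) s.1])) => d.
  apply: contrapT => no'; apply: no; exists d => p u pd up.
  apply: contrapT => no; apply: no'; exists (p, u); split=> // a Aa ad ap.
  by apply: no; exists a.
pose cs d := undup [seq x.1 | x <- (s d).1].
have f_inj : injective f.
  move=> a b ab; have [/f_lt|//|/f_lt] := o1_total hW a b; rewrite ab => -[N /(_ N)];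
  by rewrite ltnn leqnn => /(_ isT).
have sep d : exists N, injective (fun j : 'I_(size (cs d)) => mkseq (f (nth d (cs d) j)) N).
  have ex (ij : 'I_(size (cs d)) * 'I_(size (cs d))) : exists x,
      f (nth d (cs d) ij.1) x = f (nth d (cs d) ij.2) x -> ij.1 = ij.2.
    apply: contrapT => no'; apply: no'.
    have [e|ne] := pselect (f (nth d (cs d) ij.1) = f (nth d (cs d) ij.2)).
      exists 0%N => _; apply/val_inj/eqP.
      by rewrite -(nth_uniq d (ltn_ord _) (ltn_ord _) (undup_uniq _)) (f_inj _ _ e).
    have [x nx] : exists x, f (nth d (cs d) ij.1) x <> f (nth d (cs d) ij.2) x.
      by apply/existsNP => e; apply: ne; exact/funext.
    by exists x.
  have [x xP] := choice ex; exists (\max_ij x ij).+1 => i j e.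
  have xN : (x (i, j) < (\max_ij x ij).+1)%N by rewrite ltnS leq_bigmax.
  apply: (xP (i, j)) => /=.
  by have := congr1 (fun s => nth 0%N s (x (i, j))) e; rewrite !nth_mkseq.
have [N NP] := choice sep.
have thr d : exists l0, forall b, b \in cs d -> forall x, (l0 <= x)%N -> (f d x <= f b x)%N.
  have thr1 (j : 'I_(size (cs d))) : exists n, forall x,
      (n <= x)%N -> (f d x < f (nth d (cs d) j) x)%N.
    apply: f_lt; have : nth d (cs d) j \in cs d by exact: mem_nth.
    rewrite mem_undup => /mapP[q qs ->]; have [+ _ _] := sP d; exact.
  have [n nP] := choice thr1; exists (\max_j n j)%N => b bs x nx.
  rewrite -index_mem in bs; have := nP (Ordinal bs) x; rewrite /= nth_index -?index_mem //.
  move=> H; apply/ltnW/H; exact: leq_trans (leq_bigmax (Ordinal bs)) nx.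
have [l lP] := choice thr.
pose data d := (l d, N d, [seq mkseq (f b) (N d) | b <- cs d], [seq (s d).2 b | b <- cs d]).
have [D cB] := @cofinal_pigeonhole _ _ hW _ w0 setT (fun D => [set d | data d = D])
   (fun d _ => ex_intro2 _ _ (data d) I erefl) (cofinal_setT hW).
rewrite setTI in cB; set B := [set d | _] in cB.
case: D @B cB => [[[l0 N0] t0] s0] B cB.
pose k := size t0.
have BE d : B d -> [/\ l d = l0, N d = N0, [seq mkseq (f b) N0 | b <- cs d] = t0,
    [seq (s d).2 b | b <- cs d] = s0 & size (cs d) = k].
  by rewrite /k => -[-> <- <- <-]; split=> //; rewrite size_map.
pose F d (j : 'I_k) := f (nth d (cs d) j).
have Fmono d j : B d -> {homo F d j : x y / (x <= y)%N} by move=> _; exact: f_mono.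
have fF d j x : B d -> (l0 <= x)%N -> (f d x <= F d j x)%N.
  move=> /BE[<- _ _ _ sz]; apply: lP; apply: mem_nth; by rewrite sz.
have [A' [B' [n [c [AA BB S]]]]] := oscillation_start Fmono fF cA cB (@subset_refl _ B).
pose t (j : 'I_k) := nth [::] t0 j.
have FE d j : B d -> mkseq (F d j) N0 = t j.
  move=> /BE[_ _ tE _ sz]; rewrite /t -tE (nth_map d) // sz; exact: ltn_ord.
have tinj : injective t.
  have [d [Bd _]] := cB w0; move=> i j; rewrite -!(FE d) // /F.
  have [_ NE _ _ sz] := BE d Bd; have := NP d; rewrite NE => inj e.
  have is_ : (i < size (cs d))%N by rewrite sz.
  have js : (j < size (cs d))%N by rewrite sz.
  by have /(congr1 val)/= := inj (Ordinal is_) (Ordinal js) e; exact: val_inj.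
have [i iP] := @code_pattern_independent k N0 t c (fun j => nth false s0 j) tinj.
have [a [d [/AA Aa /BB Bd ad adl]]] := oscillation_all Fmono fF i S.
have [_ up nope] := sP d; apply: (nope a Aa ad) => q qp.
have [_ _ _ sE sz] := BE d Bd.
have qs : q.1 \in cs d by rewrite mem_undup; exact: map_f.
have jk : (index q.1 (cs d) < k)%N by rewrite -sz index_mem.
rewrite /scale_point -(up q qp).
have Fj : F d (Ordinal jk) = f q.1 by rewrite /F /= nth_index.
have := iP (Ordinal jk) (f q.1); rewrite -Fj FE // => /(_ erefl).
by rewrite -adl Fj => ->; rewrite /= -sE (nth_map d) ?sz // nth_index.
Qed.

End Scale.

(** * Covers of the Cantor cube that increase with a function *)

Section TailDense.
Variables (W : choiceType) (lt : W -> W -> Prop) (hW : omega1_like lt) (w0 : W).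

Let lt_trans := o1_trans hW.

Definition tail_dense (S : set (W -> bool)) (d : W) := forall p u,
  above lt d p -> extends u p -> exists u', S u' /\ extends u' p.

Definition le_eventually (g h : nat -> nat) :=
  exists N, forall k, (N <= k)%N -> (g k <= h k)%N.

Variable L : (nat -> nat) -> set (W -> bool).
Hypotheses (L_mono : forall g h, le_fun g h -> L g `<=` L h)
  (L_cover : forall u, exists g, L g u).

(** A pattern missed by [L (G w i)] is placed in the interval between [F w i] and
    [F w i.+1]; the point [u] that glues all of them is in no [L g]. *)
Lemma tail_dense_dominating (G : W -> nat -> nat -> nat) :
  (forall h, exists w i, le_fun h (G w i)) -> exists g d, tail_dense (L g) d.
Proof.
move=> Gdom; apply: contrapT => no.
have [s sP] : {s : (nat -> nat) * W -> pattern W * (W -> bool) & forall x,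
    [/\ above lt x.2 (s x).1, extends (s x).2 (s x).1 &
        forall u, L x.1 u -> ~ extends u (s x).1]}.
  apply: (@choice _ _ (fun x (s : pattern W * (W -> bool)) =>
    [/\ above lt x.2 s.1, extends s.2 s.1 & forall u, L x.1 u -> ~ extends u s.1])).
  move=> [g d] /=; apply: contrapT => no'; apply: no; exists g, d => p u pd up.
  apply: contrapT => no; apply: no'; exists (p, u); split=> // v Lv vp.
  by apply: no; exists v.
have [nx nxP] : {nx : (nat -> nat) * W -> W & forall x, lt x.2 (nx x) /\
    forall q, q \in (s x).1 -> lt q.1 (nx x)}.
  apply: (@choice _ _ (fun x y => lt x.2 y /\ forall q, q \in (s x).1 -> lt q.1 y)) => x.
  have [y [xy yP]] := o1_bound_seq hW x.2 [seq q.1 | q <- (s x).1].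
  by exists y; split=> // q qs; apply/yP/map_f.
have [|w F F' t FF' [h ?]|w F|F FP] := @well_founded_choice W (nat -> W) (fun=> w0) lt
  (fun w F t => (forall v, lt v w -> forall i, lt (F v i) (t 0%N)) /\
     forall i, t i.+1 = nx (G w i, t i)).
- exact: o1_wf hW.
- by split=> // v vw i; rewrite -FF'//; exact: h.
- have [r rP] := o1_segment hW w.
  have [d [_ dP]] := o1_bound hW w0 (fun x : nat * nat => F (r x.1) x.2).
  exists (fun i => iteri i (fun i d => nx (G w i, d)) d); split=> //.
  by move=> v /(o1_ltW hW)/rP[j <-] i; exact: (dP (j, i)).
have Fup w i : lt (F w i) (F w i.+1).
  by have [_ ->] := FP w; have [] := nxP (G w i, F w i).
have Fincr w i j : (i < j)%N -> ~ lt (F w j) (F w i.+1).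
  elim: j => // j ih; rewrite ltnS leq_eqVlt => /orP[/eqP->|/ih n]; first exact: o1_irr hW _.
  by move=> jw; apply: n; exact: lt_trans (Fup w j) jw.
have Fbelow w i : ~ lt (F w i) (F w 0%N).
  elim: i => [|i ih]; first exact: o1_irr hW _.
  by move=> iw; apply: ih; exact: lt_trans (Fup w i) iw.
(* This disjointness is what allows the patterns to be glued. *)
have Funiq w i v j b : lt (F w i) b -> lt b (F w i.+1) -> lt (F v j) b -> lt b (F v j.+1) ->
    w = v /\ i = j.
  have one w1 i1 v1 j1 : lt w1 v1 -> lt b (F w1 i1.+1) -> lt (F v1 j1) b -> False.
    move=> wv bw vb; have [/(_ w1 wv i1.+1) h _] := FP v1.
    by apply: (Fbelow v1 j1); exact: lt_trans vb (lt_trans bw h).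
  move=> wb bw vb bv; have [wv|wv|vw] := o1_total hW w v.
  - by case: (one _ _ _ _ wv bw vb).
  - subst v; split=> //; have [ij|ji|//] := ltngtP i j.
      by case: (Fincr w i j ij); exact: lt_trans vb bw.
    by case: (Fincr w j i ji); exact: lt_trans wb bv.
  - by case: (one _ _ _ _ vw bv wb).
pose u b := `[< exists w i, [/\ lt (F w i) b, lt b (F w i.+1) & (s (G w i, F w i)).2 b] >].
have [g Lu] := L_cover u; have [w [i gG]] := Gdom g.
have [pa sp nope] := sP (G w i, F w i).
apply: (nope u (L_mono gG Lu)) => q qp; rewrite -(sp q qp).
have wq : lt (F w i) q.1 by exact: pa.
have qw : lt q.1 (F w i.+1).
  by have [_ ->] := FP w; have [_] := nxP (G w i, F w i); apply.
apply/asboolP/idP => [[v [j [vq qv]]]|sq]; last by exists w, i.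
by have [<- <-] := Funiq w i v j q.1 wq qw vq qv.
Qed.

(** The conditions are the functions on countable initial segments, and a stable
    branch below the condition [(v, d)] gives, for every [e], a function [G e] good
    for all the patterns between [d] and [e]. *)
Lemma tail_dense_bounded :
  (forall G : W -> nat -> nat, exists h, forall w, le_eventually (G w) h) ->
  exists g d, tail_dense (L g) d.
Proof.
move=> bounded.
pose C := ((W -> bool) * W)%type.
pose le (c' c : C) := ~ lt c'.2 c.2 /\ forall b, ~ lt c.2 b -> c'.1 b = c.1 b.
pose H h (c : C) := exists u, L h u /\ forall b, ~ lt c.2 b -> u b = c.1 b.
have nlt_trans a b c : ~ lt a b -> ~ lt b c -> ~ lt a c.
  by move=> ab bc ac; apply: ab; exact (o1_lt_le_trans hW ac bc).
have le_refl c : le c c by split=> //; exact: o1_irr hW _.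
have le_trans a b c : le a b -> le b c -> le a c.
  move=> [ab abE] [bc bcE]; split=> [|x cx]; first exact: nlt_trans bc.
  by rewrite abE ?bcE //; exact: nlt_trans cx.
have le_lim (c : nat -> C) : (forall n, le (c n.+1) (c n)) ->
    exists c', forall n, le c' (c n).
  move=> cS; have c_le n m : (n <= m)%N -> le (c m) (c n).
    move/subnKC <-; elim: (m - n)%N => [|k ih]; first by rewrite addn0.
    by rewrite addnS; exact: le_trans (cS _) ih.
  have [d [_ dP]] := o1_bound hW w0 (fun n => (c n).2).
  exists (fun b => `[< exists n, ~ lt (c n).2 b /\ (c n).1 b >], d) => n.
  split=> [|b nb] /=; first exact: (o1_ltW hW (dP n)).
  apply/asboolP/idP => [[m [mb cm]]|cn]; last by exists n.
  have [/c_le[_ E]|/ltnW/c_le[_ E]] := leqP n m; first by rewrite -E.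
  by rewrite E.
have H_mono h c c' : le c' c -> H h c' -> H h c.
  move=> [cc E] [u [Lu uE]]; exists u; split=> // b cb.
  by rewrite uE ?E //; exact: nlt_trans cb.
have H_all c : exists h, H h c.
  by have [h Lh] := L_cover c.1; exists h, c.1.
have [[v d] [g gP]] := stable_branch le_refl le_trans le_lim H_mono H_all ((fun=> false), w0).
have meet p u n : above lt d p -> extends u p ->
    exists h, agree_below n g h /\ exists u', L h u' /\ extends u' p.
  move=> pd up; have [e [de eP]] := o1_bound_seq hW d [seq q.1 | q <- p].
  have [|h [gh [u' [Lu' u'E]]]] :=
      gP (fun b => if `[< lt d b >] then u b else v b, e) n.
    by split=> [|b db] /=; [exact (o1_ltW hW de)|rewrite asboolF].
  exists h; split=> //; exists u'; split=> // q qp.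
  rewrite u'E /= ?asboolT ?up//; first exact: pd.
  by apply/(o1_ltW hW)/eP/map_f.
have [G GP] : {G : W -> nat -> nat & forall e p u, above lt d p -> extends u p ->
    (forall q, q \in p -> ~ lt e q.1) -> exists u', L (G e) u' /\ extends u' p}.
  apply: (@choice _ _ (fun e h => forall p u, above lt d p -> extends u p ->
    (forall q, q \in p -> ~ lt e q.1) -> exists u', L h u' /\ extends u' p)) => e.
  have [E EP] := pattern_enum hW e.
  have [h hP] : {h : nat -> nat -> nat & forall k, agree_below k g (h k) /\
      forall u, above lt d (E k) -> extends u (E k) ->
        exists u', L (h k) u' /\ extends u' (E k)}.
    apply: (@choice _ _ (fun k h => agree_below k g h /\ forall u, above lt d (E k) ->
      extends u (E k) -> exists u', L h u' /\ extends u' (E k))) => k.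
    have [[u [ku uk]]|no] := pselect (exists u, above lt d (E k) /\ extends u (E k)).
      by have [h [? ?]] := meet (E k) u k ku uk; exists h.
    by exists g; split=> // u ku uk; case: no; exists u.
  have [h' h'P] := agree_bound (fun k => (hP k).1).
  exists h' => p u pd up /EP[k kp]; subst p.
  have [_ /(_ u pd up)[u' [Lu' u'E]]] := hP k.
  by exists u'; split=> //; exact: L_mono (h'P k) _ Lu'.
have [h hP] := bounded G.
have [|k ck] := @cofinal_pigeonhole _ _ hW _ w0 setT
    (fun k => [set e | le_fun (G e) (fun x => maxn (h x) k)]) _ (cofinal_setT hW).
  move=> e _; have [N NP] := hP e; exists (\max_(x < N) G e x)%N => // x.
  have [Nx|xN] := leqP N x; first by rewrite leq_max NP.
  by rewrite leq_max (@leq_bigmax _ (fun x : 'I_N => G e x) (Ordinal xN)) orbT.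
exists (fun x => maxn (h x) k), d => p u pd up.
have [e0 [_ e0P]] := o1_bound_seq hW d [seq q.1 | q <- p].
have [e [[_ Gk] e0e]] := ck e0.
have [q qp|u' [Lu' u'p]] := GP e p u pd up.
  apply: (o1_ltW hW); exact: lt_trans (e0P _ (map_f _ qp)) e0e.
by exists u'; split=> //; exact: L_mono Gk _ Lu'.
Qed.

(** The branch [g] is such that for every [n] cofinally many points [e a] lie in
    [L (ga a)] with [ga a] equal to [g] below [n]; so finitely many of them for each
    [n] can be collected in one [L H].  Which ones is decided by [h]: for a pattern,
    [idx] gives for every [n] the number of a point that extends it, and [h] must
    exceed that number for at least one [n]. *)
Lemma tail_dense_unbounded (G : W -> nat -> nat) :
  (forall h, exists w, ~ le_eventually (G w) h) ->
  (forall G : W -> nat -> nat -> nat, exists h, forall w i, ~ le_fun h (G w i)) ->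
  exists g d, tail_dense (L g) d.
Proof.
move=> Gunb nondom.
have [f [f_incr Gf f_lt]] := scale_exists hW G.
have f_unb h : exists b, ~ lt_eventually (f b) h.
  have [b nb] := Gunb h; exists b => -[N NP]; apply: nb; exists N => k /NP.
  by apply: leq_trans; apply: leq_trans (Gf b k) (leqnSn _).
pose e := scale_point f; have [ga gaP] := choice (fun a => L_cover (e a)).
pose A s := [set a | mkseq (ga a) (size s) = s].
have [nx nxP] : {nx : seq nat -> nat &
    forall s, cofinal lt (A s) -> cofinal lt (A (rcons s (nx s)))}.
  apply: (@choice _ _ (fun s x => cofinal lt (A s) -> cofinal lt (A (rcons s x)))) => s.
  have [cA|] := pselect (cofinal lt (A s)); last by exists 0%N.
  have [x cx] := @cofinal_pigeonhole _ _ hW nat w0 _ (fun x => [set a | ga a (size s) = x])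
    (fun a _ => ex_intro2 _ _ (ga a (size s)) I erefl) cA.
  exists x => _; apply: cofinal_sub cx => a [as_ ax] /=.
  by rewrite /A /= size_rcons mkseqS ax as_.
pose fix x n := if n is m.+1 then rcons (x m) (nx (x m)) else [::].
pose g n := nx (x n).
have xE n : x n = mkseq g n by elim: n => // n ih /=; rewrite mkseqS -ih.
have xA n : cofinal lt (A (x n)).
  elim: n => [|n ih] /=; last exact: nxP.
  by apply: cofinal_sub (cofinal_setT hW) => a _.
have agreeA n a : A (x n) a -> agree_below n g (ga a).
  rewrite /A /= xE size_mkseq => E k kn.
  by have := congr1 (fun s => nth 0%N s k) E; rewrite !nth_mkseq.
have dense n := scale_point_finally_dense hW w0 f_incr f_lt f_unb (xA n).
have [dn dnP] := choice dense.
have [d [_ dP]] := o1_bound hW w0 dn.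
have [r rP] := o1_segment hW d.
have [E EP] := choice (pattern_enum hW).
pose hit b i n m := above lt d (E b i) -> (exists u, extends u (E b i)) ->
  A (x n) (r m) /\ extends (e (r m)) (E b i).
have [idx idxP] : {idx : W * nat * nat -> nat & forall y, hit y.1.1 y.1.2 y.2 (idx y)}.
  apply: (@choice _ _ (fun y m => hit y.1.1 y.1.2 y.2 m)) => -[[b i] n] /=.
  have [[pd [u up]]|no] := pselect (above lt d (E b i) /\ exists u, extends u (E b i)).
    have [|a [Aa ad ap]] := dnP n (E b i) u _ up.
      by move=> q /pd; exact: lt_trans (dP n).
    have [|m ra] := rP a; last by exists m => _ _; rewrite ra.
    by apply: (o1_ltW hW); exact: lt_trans ad (dP n).
  by exists 0%N => pd up; case: no.
have [h hP] := nondom (fun b i n => idx (b, i, n)).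
pose H k := (g k + \sum_(m < \sum_(n < k.+1) h n) ga (r m) k)%N.
exists H, d => p u pd up.
have [b [_ bP]] := o1_bound_seq hW w0 [seq q.1 | q <- p].
have [|i Ep] := EP b p; first by move=> q qp; apply/(o1_ltW hW)/bP/map_f.
have /existsNP[n /negP] := hP b i; rewrite -ltnNge => nh.
have := idxP (b, i, n); rewrite /hit /= Ep => /(_ pd (ex_intro _ u up)).
set m := idx _ in nh *; move=> [Am ep]; exists (e (r m)); split=> //.
apply: L_mono (gaP (r m)) => k; have [kn|nk] := ltnP k n.
  by rewrite (agreeA n _ Am) // leq_addr.
have mk : (m < \sum_(n < k.+1) h n)%N.
  by rewrite (bigD1 (Ordinal (nk : n < k.+1)%N)) //= ltn_addr.
by rewrite /H (bigD1 (Ordinal mk)) //= addnCA leq_addr.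
Qed.

Theorem tail_dense_exists : exists g d, tail_dense (L g) d.
Proof.
have [[G]|nondom] := pselect (exists G : W -> nat -> nat -> nat,
    forall h, exists w i, le_fun h (G w i)).
  exact: tail_dense_dominating.
have [|/existsNP[G Gunb]] := pselect (forall G : W -> nat -> nat,
    exists h, forall w, le_eventually (G w) h); first exact: tail_dense_bounded.
apply: (tail_dense_unbounded (G := G)).
  by move=> h; apply/existsNP => Gh; apply: Gunb; exists h.
move=> G'; apply: contrapT => no; apply: nondom; exists G' => h.
apply: contrapT => no'; apply: no; exists h => w i hG.
by apply: no'; exists w, i.
Qed.

End TailDense.

(** * Closed sets that map onto a tail of the cube *)

Lemma compact_directed (X : topologicalType) (J : Type) (i0 : J) (F : J -> set X) :
  compact [set: X] -> (forall i, closed (F i)) -> (forall i, F i !=set0) ->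
  (forall i j, exists k, F k `<=` F i `&` F j) -> exists x, forall i, F i x.
Proof.
move=> cX Fcl Fn0 Fdir.
have FF : ProperFilter (filter_from setT F).
  apply: filter_from_proper; last by move=> i _; exact: Fn0.
  apply: filter_from_filter; first by exists i0.
  by move=> i j _ _; have [k Fk] := Fdir i j; exists k.
have [x [_ clx]] := cX _ FF filterT.
exists x => i; apply: Fcl => U Ux.
by have [y [Fy Uy]] := clx (F i) U (ex_intro2 _ _ i I (fun _ H => H)) Ux; exists y.
Qed.

Lemma hausdorff_prod (X Y : topologicalType) :
  hausdorff_space X -> hausdorff_space Y -> hausdorff_space (X * Y)%type.
Proof.
move=> hX hY [x y] [x' y'] cl; congr pair.
  apply: hX => U V Ux Vx; have [||[a b] [/= [Ua _] [Va _]]] := cl (U `*` setT) (V `*` setT).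
  - by exists (U, setT) => //; split=> //; exact: filterT.
  - by exists (V, setT) => //; split=> //; exact: filterT.
  - by exists a.
apply: hY => U V Uy Vy; have [||[a b] [/= [_ Ub] [_ Vb]]] := cl (setT `*` U) (setT `*` V).
- by exists (setT, U) => //; split=> //; exact: filterT.
- by exists (setT, V) => //; split=> //; exact: filterT.
- by exists b.
Qed.

Section OntoCube.
Variables (W : choiceType) (lt : W -> W -> Prop) (hW : omega1_like lt) (w0 : W).
Variables (X : topologicalType) (Xcompact : compact [set: X]) (f : X -> W -> bool).
Hypotheses (f_closed : forall b e, closed [set x | f x b = e])
  (f_onto : forall u, exists x, f x = u).
Variable K : (nat -> nat) -> set (X * X).
Hypotheses (K_closed : forall g, closed (K g))
  (K_mono : forall g h, le_fun g h -> K g `<=` K h)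
  (K_diag : forall g x, ~ K g (x, x))
  (K_cover : forall x y, x <> y -> exists g, K g (x, y)).

Let lt_trans := o1_trans hW.

(** These closed sets are the conditions ordered by inclusion; cutting by a
    cylinder or intersecting a sequence yields a condition with a larger [d]. *)
Definition onto_tail (Y : set X) (d : W) := closed Y /\
  forall u, exists x, Y x /\ forall b, lt d b -> f x b = u b.

Definition cylinder (p : pattern W) : set X := [set x | extends (f x) p].

Definition meets_square (h : nat -> nat) (Y : set X) :=
  exists x y, [/\ Y x, Y y & K h (x, y)].

Lemma cylinder_closed p : closed (cylinder p).
Proof.
rewrite (_ : cylinder p = \bigcap_(q in [set q | q \in p]) [set x | f x q.1 = q.2]).
  by apply: closed_bigI => q _; exact: f_closed.
by apply/seteqP; split=> x /= h q; exact: h.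
Qed.

Lemma fiber_closed (u : W -> bool) (d : W) :
  closed [set x | forall b, lt d b -> f x b = u b].
Proof.
rewrite (_ : mkset _ = \bigcap_(b in [set b | lt d b]) [set x | f x b = u b]).
  by apply: closed_bigI => b _; exact: f_closed.
by apply/seteqP; split=> x /= h b; exact: h.
Qed.

Lemma onto_tail_lim (Y : nat -> set X) : (forall n, exists d, onto_tail (Y n) d) ->
  (forall n, Y n.+1 `<=` Y n) -> exists d, onto_tail (\bigcap_n Y n) d.
Proof.
move=> Yt YS; have [d dP] := choice Yt; have [d' [_ d'P]] := o1_bound hW w0 d.
have Ymono n m : (n <= m)%N -> Y m `<=` Y n.
  move/subnKC <-; elim: (m - n)%N => [|k ih]; first by rewrite addn0.
  by rewrite addnS => x /YS/ih.
exists d'; split; first by apply: closed_bigI => n _; case: (dP n).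
move=> u; have [|n|i j|x xP] := @compact_directed X nat 0%N
    (fun n => Y n `&` [set x | forall b, lt d' b -> f x b = u b]) Xcompact.
- by move=> n; apply: closedI; [case: (dP n)|exact: fiber_closed].
- have [_ /(_ u)[x [Yx xu]]] := dP n; exists x; split=> // b d'b.
  by apply: xu; exact: lt_trans (d'P n) d'b.
- exists (maxn i j) => x [Yx xu]; split; split=> //.
    exact: Ymono (leq_maxl _ _) _ Yx.
  exact: Ymono (leq_maxr _ _) _ Yx.
by exists x; split=> [n _|]; [case: (xP n)|case: (xP 0%N)].
Qed.

Lemma onto_tail_cylinder Y d p u : onto_tail Y d -> above lt d p -> extends u p ->
  exists d', onto_tail (Y `&` cylinder p) d'.
Proof.
move=> [Yc Yd] pd up; have [d' [dd' d'P]] := o1_bound_seq hW d [seq q.1 | q <- p].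
exists d'; split; first by apply: closedI => //; exact: cylinder_closed.
move=> v; have [x [Yx xP]] := Yd (fun b => if `[< lt d' b >] then v b else u b).
exists x; split; last by move=> b d'b; rewrite xP ?asboolT //; exact: lt_trans d'b.
split=> // q qp; rewrite xP ?asboolF ?up //; last exact: pd.
exact/(o1_ltW hW)/d'P/map_f.
Qed.

Definition meets_all_squares (h : nat -> nat) (Y : set X) (d : W) :=
  forall p u, above lt d p -> extends u p -> meets_square h (Y `&` cylinder p).

(** Two points of [Y] that differ at the coordinate [a] and agree with [u] after it
    lie in some [K g]; so the sets [L g] cover the cube. *)
Lemma onto_tail_meets Y d : onto_tail Y d -> exists h d', meets_all_squares h Y d'.
Proof.
move=> [Yc Yd]; have [a [da _]] := o1_bound2 hW d d.
pose L g u := exists x y, [/\ Y x, Y y, K g (x, y) &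
  forall b, lt a b -> f x b = u b /\ f y b = u b].
have [||h [d' hd']] := @tail_dense_exists W lt hW w0 L.
- by move=> g h gh u [x [y [? ? Kg ?]]]; exists x, y; split=> //; exact: K_mono Kg.
- move=> u; pose v e b := if b == a then e else u b.
  have [x [Yx xv]] := Yd (v false); have [y [Yy yv]] := Yd (v true).
  have [|g Kg] := K_cover (x := x) (y := y).
    by move=> xy; have := xv a da; rewrite xy yv // /v eqxx.
  exists g, x, y; split=> // b ab; have db := lt_trans da ab.
  have ba : b == a = false by apply/eqP => ba; subst b; case: (o1_irr hW ab).
  by rewrite xv // yv // /v ba.
have [e [ae d'e]] := o1_bound2 hW a d'; exists h, e => p u pe up.
have [|u' [[x [y [Yx Yy Kh xy]]] u'p]] := hd' p u _ up.
  by move=> q /pe; exact: lt_trans.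
exists x, y; split=> //; split=> // q qp; rewrite -u'p //.
  by have [] := xy q.1 (lt_trans ae (pe q qp)).
by have [] := xy q.1 (lt_trans ae (pe q qp)).
Qed.

Lemma onto_tail_minimal Y d : onto_tail Y d -> exists2 Z, onto_tail Z d /\ Z `<=` Y &
  forall Z', Z' `<=` Z -> onto_tail Z' d -> Z' = Z.
Proof.
move=> Yd; pose T := {Z | onto_tail Z d /\ Z `<=` Y}.
pose R (s t : T) := `[< sval t `<=` sval s >].
have [||||[Z [Zd ZY]] Zmin] := @Zorn T R.
- by move=> t; apply/asboolP.
- by move=> r s t /asboolP rs /asboolP st; apply/asboolP => x /st/rs.
- move=> [s sY] [t tY] /asboolP st /asboolP ts.
  have E : s = t by apply/seteqP; split.
  by subst t; congr exist; exact: Prop_irrelevance.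
- move=> A Atot; have [[s0 As0]|nA] := pselect (exists s, A s); last first.
    by exists (exist _ Y (conj Yd (@subset_refl _ Y))) => s As; case: nA; exists s.
  pose Z := \bigcap_(s in A) sval s.
  suff ZT : onto_tail Z d /\ Z `<=` Y.
    by exists (exist _ Z ZT) => s As; apply/asboolP => x; exact.
  split; last by move=> x /(_ s0 As0); case: (svalP s0) => _; exact.
  split; first by apply: closed_bigI => s _; case: (svalP s) => -[].
  move=> u; have [|s|s t|x xP] := @compact_directed X {s | A s} (exist _ s0 As0)
    (fun s => sval (sval s) `&` [set x | forall b, lt d b -> f x b = u b]) Xcompact.
  + move=> s; apply: closedI; last exact: fiber_closed.
    by case: (svalP (sval s)) => -[].
  + by have [[_ /(_ u)[x ?]] _] := svalP (sval s); exists x.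
  + have [/asboolP st|/asboolP ts] := Atot _ _ (svalP s) (svalP t).
      by exists t => x [tx xu]; split; split=> //; exact: st.
    by exists s => x [sx xu]; split; split=> //; exact: ts.
  exists x; split; last by case: (xP (exist _ s0 As0)).
  by move=> s As; case: (xP (exist _ s As)).
exists Z => // Z' Z'Z Z'd.
have Z'T : onto_tail Z' d /\ Z' `<=` Y by split=> // x /Z'Z/ZY.
by have /(congr1 sval) := Zmin (exist _ Z' Z'T) (asboolT Z'Z).
Qed.

(** A point [z] of [Z] has an open neighbourhood [O] whose square misses [K h].  By
    minimality the tail of some [u] is not attained on [Z] outside [O], and by
    compactness finitely many values of [u] already force a point of [Z] into
    [O]. *)
Lemma minimal_avoids Z d h : onto_tail Z d ->
  (forall Z', Z' `<=` Z -> onto_tail Z' d -> Z' = Z) -> ~ meets_all_squares h Z d.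
Proof.
move=> [Zc Zd] Zmin meets; have [z [Zz _]] := Zd (fun=> false).
have : nbhs (z, z) (~` K h).
  by apply: open_nbhs_nbhs; split; [exact: closed_openC|exact: K_diag].
move=> [[U V] /= [Uz Vz] UVK].
pose O := (U `&` V)°.
have Oz : O z by apply: filterI.
have [u /forallNP uP] : exists u, ~ exists x, (Z `\` O) x /\ forall b, lt d b -> f x b = u b.
  apply/existsNP => Z'onto; suff /(congr1 (@^~ z)) : Z `\` O = Z.
    by rewrite propeqE => -[_ /(_ Zz)[]].
  apply: Zmin; first by move=> x [].
  split=> //; apply: closedI => //; apply: open_closedC; exact: open_interior.
have [p] : exists p, [/\ above lt d p, extends u p & forall x, Z x -> cylinder p x -> O x].
  apply: contrapT => no; pose J := {p | above lt d p /\ extends u p}.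
  have nilI : above lt d [::] /\ extends u [::] by [].
  have [|s|[s [sd su]] [t [td tu]]|x xP] := @compact_directed X J (exist _ _ nilI)
     (fun p => (Z `\` O) `&` cylinder (sval p)) Xcompact.
  - move=> s; apply: closedI; last exact: cylinder_closed.
    by apply: closedI => //; apply: open_closedC; exact: open_interior.
  - apply: contrapT => ne; apply: no; exists (sval s); have [sd su] := svalP s.
    split=> // x Zx sx; apply: contrapT => nO; apply: ne; exists x; split=> //.
  - have stI : above lt d (s ++ t) /\ extends u (s ++ t).
      by split=> q; rewrite mem_cat => /orP[];
        [exact: sd|exact: td|exact: su|exact: tu].
    exists (exist _ (s ++ t) stI) => x [Zx stx] /=; split; split=> // q qs; apply: stx.
      by rewrite mem_cat qs.
    by rewrite mem_cat qs orbT.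
  have [Zx _] := xP (exist _ _ nilI); apply: (uP x); split=> // b db.
  have bI : above lt d [:: (b, u b)] /\ extends u [:: (b, u b)].
    by split=> q; rewrite inE => /eqP ->.
  by have [_ /(_ (b, u b))] := xP (exist _ _ bI); apply; rewrite inE.
case=> pd up pO; have [x [y [[Zx px] [Zy py] Kxy]]] := meets p u pd up.
have [Ux _] := interior_subset (pO x Zx px); have [_ Vy] := interior_subset (pO y Zy py).
exact: (UVK (x, y) (conj Ux Vy) Kxy).
Qed.

(** A stable branch is needed because the coordinate beyond which [K h] meets all
    the squares depends on the pattern [p] that cuts [Z].  The sequence [D] closes
    off: the part of a pattern that lies below some [D k] is one of countably many
    patterns, and the rest lies beyond the coordinate that belongs to it. *)
Theorem no_monotone_cover : False.
Proof.
pose C := {Y : set X | exists d, onto_tail Y d}.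
pose le (c' c : C) := sval c' `<=` sval c.
pose H h (c : C) := exists d, meets_all_squares h (sval c) d.
have le_lim (c : nat -> C) : (forall n, le (c n.+1) (c n)) ->
    exists c', forall n, le c' (c n).
  move=> cS; have [|d dP] := @onto_tail_lim (fun n => sval (c n)) _ cS.
    by move=> n; exact: svalP (c n).
  exists (exist (fun Y => exists d, onto_tail Y d) _ (ex_intro _ d dP)) => n x cx.
  exact: (cx n I).
have H_mono h (c c' : C) : le c' c -> H h c' -> H h c.
  move=> cc [d dP]; exists d => p u pd up.
  by have [x [y [[/cc ? ?] [/cc ? ?] ?]]] := dP p u pd up; exists x, y.
have H_all c : exists h, H h c.
  by case: c => Y [d Yd]; exact: onto_tail_meets Yd.
have X_tail : onto_tail setT w0.
  by split=> [|u]; [exact: closedT|have [x <-] := f_onto u; exists x].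
have [c [g gP]] := @stable_branch C le (fun c => @subset_refl _ _)
  (fun a b c ab bc => subset_trans ab bc) le_lim H H_mono H_all
  (exist (fun Y => exists d, onto_tail Y d) _ (ex_intro _ w0 X_tail)).
have [d cd] := svalP c; have [Z [Zd Zc] Zmin] := onto_tail_minimal cd.
have [s sP] : {s : pattern W * nat -> (nat -> nat) * W & forall x u,
    above lt d x.1 -> extends u x.1 -> agree_below x.2 g (s x).1 /\
    meets_all_squares (s x).1 (Z `&` cylinder x.1) (s x).2}.
  apply: (@choice _ _ (fun x (s : (nat -> nat) * W) => forall u,
    above lt d x.1 -> extends u x.1 -> agree_below x.2 g s.1 /\
    meets_all_squares s.1 (Z `&` cylinder x.1) s.2)) => -[p n] /=.
  have [[u [pd up]]|no] := pselect (exists u, above lt d p /\ extends u p); last first.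
    by exists (g, w0) => u pd up; case: no; exists u.
  have Zp := onto_tail_cylinder Zd pd up.
  have [|h [gh [e he]]] := gP (exist (fun Y => exists d, onto_tail Y d) _ Zp) n.
    by move=> x [/Zc].
  by exists (h, e).
have [E EP] := choice (pattern_enum hW).
have [nx nxP] : {nx : W -> W & forall e, lt e (nx e) /\
    forall i n, lt (s (E e i, n)).2 (nx e)}.
  apply: (@choice _ _ (fun e e' => lt e e' /\ forall i n, lt (s (E e i, n)).2 e')) => e.
  have [e' [ee' e'P]] := o1_bound hW e (fun x : nat * nat => (s (E e x.1, x.2)).2).
  by exists e'; split=> // i n; exact: (e'P (i, n)).
pose D k := iter k nx d.
pose h n := if unpickle n is Some (k, i) then
  if pselect (exists u, above lt d (E (D k) i) /\ extends u (E (D k) i))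
  then (s (E (D k) i, n)).1 else g else g.
have hg n : agree_below n g (h n).
  rewrite /h; case: unpickle => // -[k i]; case: pselect => // -[u [pd up]].
  by have [] := sP (E (D k) i, n) u pd up.
have [H' H'P] := agree_bound hg.
apply: (@minimal_avoids Z d H' Zd Zmin) => p u pd up.
(* [low k] selects the coordinates of [p] up to [D k]; for the [k] below, the other
   coordinates are beyond every [D m]. *)
pose low k (q : W * bool) := `[< ~ lt (D k) q.1 >].
have [k kP] : exists k, forall q, q \in p -> ~~ low k q -> forall m, ~~ low m q.
  have ex (q : W * bool) : exists k, ~~ low k q -> forall m, ~~ low m q.
    have [[k lowk]|no] := pselect (exists k, low k q); first by exists k; rewrite lowk.
    by exists 0%N => _ m; apply/negP => lm; apply: no; exists m.
  have [kq kqP] := choice ex; exists (\max_(q <- p) kq q)%N => q qp nk.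
  apply: (kqP q); apply: contra nk => /asboolP lk; apply/asboolP => Dq; apply: lk.
  have : (kq q <= \max_(q <- p) kq q)%N by exact: leq_bigmax_seq.
  move/subnKC => kE; move: Dq; rewrite -kE.
  elim: (_ - _)%N => [|j ih]; first by rewrite addn0.
  by rewrite addnS => h'; apply: ih; apply: lt_trans h'; case: (nxP (D (kq q + j)%N)).
pose p1 := [seq q <- p | low k q]; pose p2 := [seq q <- p | ~~ low k q].
have [|i Ei] := EP (D k) p1; first by move=> q; rewrite mem_filter => /andP[/asboolP].
have p1d : above lt d p1 by move=> q; rewrite mem_filter => /andP[_ /pd].
have p1u : extends u p1 by move=> q; rewrite mem_filter => /andP[_ /up].
have hE : h (pickle (k, i)) = (s (p1, pickle (k, i))).1.
  by rewrite /h pickleK Ei; case: pselect => // -[]; exists u.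
have [_ /(_ p2 u)[|q|x [y]]] := sP (p1, pickle (k, i)) u p1d p1u.
- move=> q; rewrite mem_filter => /andP[nq qp] /=.
  have /asboolPn/contrapT Dq := kP q qp nq k.+1.
  by apply: lt_trans Dq; have [_] := nxP (D k); rewrite -Ei; exact.
- by rewrite mem_filter => /andP[_ /up].
rewrite -hE => -[[[Zx x1] x2] [[Zy y1] y2] Kxy]; exists x, y.
have cat z : cylinder p1 z -> cylinder p2 z -> cylinder p z.
  move=> z1 z2 q qp; have [lq|lq] := boolP (low k q).
    by apply: z1; rewrite mem_filter lq.
  by apply: z2; rewrite mem_filter lq.
by split; [split=> //; exact: cat|split=> //; exact: cat|exact: K_mono (H'P _) _ Kxy].
Qed.

End OntoCube.

(** * The boxes of the Baire space *)

Lemma compact_le_fun (g : nat -> nat) : compact ([set h | le_fun h g] : set baire_space).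
Proof.
have := @tychonoff nat (fun=> nat) (fun k => [set i | (i <= g k)%N]).
apply => k; apply: finite_compact; exact: (@sub_finite_set _ _ `I_(g k).+1).
Qed.

Lemma compact_le_fun_bound (A : set baire_space) : compact A ->
  exists g, A `<=` [set h | le_fun h g].
Proof.
move=> cA; have bound k : exists n, forall h, A h -> (h k <= n)%N.
  have : compact [set (h : baire_space) k | h in A].
    apply: continuous_compact cA; apply: continuous_subspaceT.
    exact: (@proj_continuous nat (fun=> nat) k).
  rewrite compact_cover => /(_ nat setT (fun i => [set i]))[].
  - by move=> i _; exact: discrete_open.
  - by move=> i _; exists i.
  move=> D _ AD; exists (\max_(i <- finmap.enum_fset D) i)%N => h Ah.
  have [i iD ->] := AD (h k) (ex_intro2 _ _ h Ah erefl).
  exact: leq_bigmax_seq.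
by have [g gP] := choice bound; exists g => h Ah k; exact: gP.
Qed.

Theorem theorem7 (W : Type) (le : rel W) (hW : is_omega1 le)
    (X : topologicalType)
    (Xcompact : compact [set: X]) (Xhausdorff : hausdorff_space X)
    (f : X -> cantor_cube W) (fcont : continuous f)
    (fsurj : set_surj [set: X] [set: cantor_cube W] f) :
  ~ has_P_diagonal X.
Proof.
move=> [C [Ccompact Ccover Cmono]].
have ltP := omega1_likeP hW.
have [w0 _] : exists w0 : W, True.
  apply: contrapT => W0; have [_ + _] := hW; apply.
  by apply/countable_injP; exists (fun=> 0%N) => x; case: W0; exists x.
pose K g : set (X * X) := [set val z | z in C [set h | le_fun h g]].
apply: (@no_monotone_cover {classic W} _ ltP w0 X Xcompact f _ _ K).
- move=> b e; have : closed ((fun x => f x b) @^-1` [set e]).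
    apply: preimage_closed; last exact: discrete_closed.
    move=> x _; apply: (@continuous_comp _ _ _ f (fun u : cantor_cube W => u b)).
      exact: fcont.
    exact: (@proj_continuous {classic W} (fun=> bool) b).
  exact.
- by move=> u; have [x _ <-] := fsurj u I; exists x.
- move=> g; apply: compact_closed; first exact: hausdorff_prod.
  apply: continuous_compact; last exact/Ccompact/compact_le_fun.
  apply: continuous_subspaceT; exact: initial_continuous.
- move=> g h gh z [y Cy <-]; exists y => //.
  apply: Cmono Cy; try exact: compact_le_fun.
  by move=> u ug k; exact: leq_trans (ug k) (gh k).
- by move=> g x [y _ yx]; have := set_valP y; apply; rewrite /= yx.
- move=> x y xy; have xyD : (x, y) \in ~` @diagonal X by apply/mem_set.
  have [A cA CA] : (\bigcup_(A in [set A | compact A]) C A) (SigSub xyD) by rewrite Ccover.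
  have [g Ag] := compact_le_fun_bound cA.
  exists g, (SigSub xyD) => //; apply: Cmono CA => //; exact: compact_le_fun.
Qed.
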